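(* Let $k$ be a number field, $f\in k[t]$ a nonconstant polynomial, $E$ the elliptic curve over $k(t)$ given by $Y^2=X^3+f(t)$, and $(X_0(t),Y_0(t))\in E(k(t))$. For each $t\in k$ let $y_t=\sqrt{f(t)}$ (any choice of square root). Let $\mathfrak{p}$ be a prime of $\mathcal{O}_k$ not lying above $2$, and suppose there exists $t_{\mathfrak{p}}\in k$ with $f(t_{\mathfrak{p}})\neq 0$ and $3\mid\mathrm{ord}_{\mathfrak{p}}f(t_{\mathfrak{p}})$. Then there exists $\epsilon_{\mathfrak{p}}>0$ such that for every $t\in k$ with $|t-t_{\mathfrak{p}}|_{\mathfrak{p}}<\epsilon_{\mathfrak{p}}$ (and $t$ not a pole of $X_0,Y_0$, with $y_t\neq Y_0(t)$), and every prime $\mathfrak{q}$ of $k(y_t)$ lying above $\mathfrak{p}$, we have $3\mid\mathrm{ord}_{\mathfrak{q}}(y_t-Y_0(t))$.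
   Context: $\mathrm{ord}_{\mathfrak{p}}$ is the discrete valuation associated to the prime $\mathfrak{p}$ and $|\cdot|_{\mathfrak{p}}$ a corresponding $\mathfrak{p}$-adic absolute value. *)

(* Defs.v *)
(* Number fields are modelled as subfields of the algebraic
   complex numbers algC that are finite-dimensional over Q. *)
From HB Require Import structures.
From mathcomp Require Import all_boot all_order all_algebra all_field.
Set Implicit Arguments. Unset Strict Implicit. Unset Printing Implicit Defensive.
Import Order.TTheory GRing.Theory Num.Theory.
Local Open Scope ring_scope.

Definition is_subfield (F : algC -> Prop) : Prop :=
  F 0 /\ F 1 /\
  (forall x y, F x -> F y -> F (x + y)) /\
  (forall x, F x -> F (- x)) /\
  (forall x y, F x -> F y -> F (x * y)) /\
  (forall x, F x -> F (x^-1)).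

Definition number_field (F : algC -> Prop) : Prop :=
  is_subfield F /\
  exists (n : nat) (s : 'I_n -> algC),
    forall x, F x -> exists c : 'I_n -> rat, x = \sum_(i < n) ratr (c i) * s i.

Definition adjoin (F : algC -> Prop) (y : algC) : algC -> Prop :=
  fun z => forall G : algC -> Prop,
    is_subfield G -> (forall x, F x -> G x) -> G y -> G z.

Definition ringOI (F : algC -> Prop) (x : algC) : Prop := F x /\ x \in Aint.

Definition prime_of (F : algC -> Prop) (P : algC -> Prop) : Prop :=
  (forall x, P x -> ringOI F x) /\
  P 0 /\
  (forall x y, P x -> P y -> P (x + y)) /\
  (forall a x, ringOI F a -> P x -> P (a * x)) /\
  (exists x, P x /\ x != 0) /\
  ~ P 1 /\
  (forall x y, ringOI F x -> ringOI F y -> P (x * y) -> P x \/ P y).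

Fixpoint ipow (F : algC -> Prop) (P : algC -> Prop) (n : nat) (x : algC) : Prop :=
  match n with
  | 0 => ringOI F x
  | n'.+1 => exists s : seq (algC * algC),
      (forall ab, ab \in s -> P ab.1 /\ ipow F P n' ab.2) /\
      x = \sum_(ab <- s) ab.1 * ab.2
  end.

Definition ord_is (F : algC -> Prop) (P : algC -> Prop) (x : algC) (m : int) : Prop :=
  x != 0 /\
  exists (a b : algC) (na nb : nat),
    ringOI F a /\ ringOI F b /\ a != 0 /\ b != 0 /\ x = a / b /\
    (ipow F P na a /\ ~ ipow F P na.+1 a) /\
    (ipow F P nb b /\ ~ ipow F P nb.+1 b) /\
    m = (na%:Z - nb%:Z)%R.

Definition poly_over (F : algC -> Prop) (p : {poly algC}) : Prop :=
  forall i, F p`_i.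

(* Main.v *)
(* Put y = y_t and (X, Y) = (X_0(t), Y_0(t)). Then (y - Y)(y + Y) = -X^3 while (y - Y) + (y + Y) = 2y,
   and ord_q(2y) = ord_q(f(t))/2 is divisible by 3 because f(t) is p-adically close to f(t_p). If the two
   factors have different orders, the smaller one is ord_q(2y); if they agree, twice the order is a multiple
   of 3.

   The valuation is obtained without ideal factorization. Residue rings O/nO are finite, so the pigeonhole
   principle makes every c whose powers have a common denominator integral, and produces c in K with
   cP inside O but cP not inside P. Then P^n = {x in O : c^n x in O}, and ord_P(x) = m exactly when c^m x
   is a unit of the localization of O at P. *)
Require Import Defs.
From HB Require Import structures.
From mathcomp Require Import all_boot all_order all_algebra all_field.
From mathcomp Require Import ring zify.
From Stdlib Require Import Classical.
Import Order.TTheory GRing.Theory Num.Theory.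
Local Open Scope ring_scope.

Set Implicit Arguments. Unset Strict Implicit. Unset Printing Implicit Defensive.

(** * Algebraic integers: integral equations and denominators *)

(** [Aint] is defined through the minimal polynomial; this gives access to arbitrary monic integer
    equations. *)
Lemma AintP (x : algC) : x \in Aint <-> integralOver (intr : int -> algC) x.
Proof.
split=> [xA | [p mon_p px]].
  have [q Dq] := floorpP xA.
  exists q; last by rewrite -Dq root_minCpoly.
  have := minCpoly_monic x; rewrite Dq !monicE lead_coef_map_inj ?rmorph0 //.
    by move=> /eqP l1; apply/eqP/(intr_inj (R := algC)).
  exact: intr_inj.
apply: root_monic_Aint px _ _; first exact: monic_map.
by apply/polyOverP => i; rewrite coef_map /= intr_int.
Qed.

Lemma Aint_root (p : {poly algC}) (x : algC) :
  p \is monic -> p \is a polyOver Aint -> root p x -> x \in Aint.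
Proof.
move=> mon_p /polyOverP pA px; apply/AintP/(integral_root_monic mon_p px).
by move=> a /(nthP 0)[i _ <-]; apply/AintP.
Qed.

(** With a = x^n - x^m, the number x is a root of X^n - X^m - a, which is monic because m < n. *)
Lemma Aint_expB (x : algC) (m n : nat) :
  (m < n)%N -> x ^+ n - x ^+ m \in Aint -> x \in Aint.
Proof.
move=> lt_mn xA; pose a := x ^+ n - x ^+ m.
apply: (@Aint_root ('X^n - ('X^m + a%:P))).
- rewrite monicE lead_coefDl ?lead_coefXn // size_polyN size_polyXn ltnS.
  rewrite (leq_trans (size_polyD _ _)) // size_polyXn geq_max lt_mn.
  by rewrite (leq_trans (size_polyC_leq1 _)) // (leq_trans _ lt_mn).
- by rewrite rpredB ?rpredD ?rpredX ?polyOverX ?polyOverC.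
by rewrite rootE hornerD hornerN hornerD !hornerXn hornerC /a addrC [X in - X]addrC subrK addNr.
Qed.

(** Split a monic integer equation as x q(x) + a = 0. If a is nonzero then a/x = -q(x) is integral;
    if a = 0, divide by x and repeat. *)
Lemma Aint_dvd_int (x : algC) : x \in Aint -> x != 0 ->
  exists2 n : nat, (0 < n)%N & n%:R / x \in Aint.
Proof.
move=> xA x0; have xI := xA; move/AintP: xI => [p].
elim/poly_ind: p => [|q a IHq]; first by rewrite monicE lead_coef0 eq_sym oner_eq0.
have [->|a0] := eqVneq a 0.
  rewrite addr0 monicMr ?monicX // rmorphM /= map_polyX rootM rootX (negPf x0) orbF.
  exact: IHq.
move=> _; rewrite rmorphD rmorphM /= map_polyX map_polyC rootE !hornerE.
rewrite addr_eq0 => /eqP Da; exists `|a|%N; first by rewrite absz_gt0.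
have Dq : a%:~R / x = - (map_poly intr q).[x] :> algC by rewrite -[a%:~R]opprK -Da; field.
have aA : a%:~R / x \in Aint.
  rewrite Dq rpredN; apply: rpred_horner => //.
  by apply/polyOverP => i; rewrite coef_map Aint_int.
have -> : `|a|%N%:R = (Num.sg a)%:~R * a%:~R :> algC.
  by rewrite natr_absz {1}[`|a|]normrEsg intrM.
by rewrite -mulrA rpredM // Aint_int.
Qed.

Lemma Aint_scale (x : algC) : exists2 n : nat, (0 < n)%N & n%:R * x \in Aint.
Proof.
have [p [Dp mon_p] _] := minCpolyP x.
have := root_minCpoly x; have [q [a a0 Dpq]] := rat_poly_scale p.
have Dpm : minCpoly x = a%:~R^-1 *: map_poly intr q.
  rewrite Dp Dpq map_polyZ /= fmorphV /= ratr_int; congr (_ *: _).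
  by rewrite -map_poly_comp; apply: eq_map_poly => i /=; rewrite ratr_int.
have aC : a%:~R != 0 :> algC by rewrite intr_eq0.
rewrite Dpm rootZ ?invr_eq0 // => qx.
have lq : lead_coef q = a.
  have := minCpoly_monic x; rewrite Dpm monicE lead_coefZ lead_coef_map_inj //.
    by move=> /eqP Dl; apply: (intr_inj (R := algC)); rewrite -[LHS](mulVKf aC) Dl mulr1.
  exact: intr_inj.
have aA : a%:~R * x \in Aint.
  pose n := (size q).-1.
  have q0 : q != 0 by rewrite -lead_coef_eq0 lq.
  have sq : size q = n.+1 by rewrite prednK // lt0n size_poly_eq0.
  (* ['X^n + r] is a^(n-1) q(X/a): monic since q has leading coefficient a, and zero at a x. *)
  pose r := \sum_(i < n) (q`_i * a ^+ (n.-1 - i))%:~R *: 'X^i : {poly algC}.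
  have sr : (size r <= n)%N.
    apply: (leq_trans (size_sum _ _ _)); apply/bigmax_leqP => i _.
    by rewrite (leq_trans (size_scale_leq _ _)) // size_polyXn.
  apply: (@Aint_root ('X^n + r)).
  - by rewrite monicE lead_coefDl ?lead_coefXn // size_polyXn ltnS.
  - rewrite rpredD ?rpredX ?polyOverX // rpred_sum // => i _.
    by rewrite polyOverZ ?Aint_int // rpredX ?polyOverX.
  - have [n0|n_gt0] := posnP n.
      move: qx; rewrite (size1_polyC (p := q)) ?sq ?n0 // map_polyC rootC intr_eq0.
      by rewrite -lq lead_coefE -/n n0 => /eqP q00; rewrite -lq lead_coefE -/n n0 q00 eqxx in a0.
    move: qx; rewrite !rootE horner_coef (size_map_inj_poly (intr_inj (R:=algC))) // sq.
    rewrite big_ord_recr /= !hornerE horner_sum => /eqP qx.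
    apply/eqP; transitivity (a%:~R ^+ n.-1 * 0 : algC); last by rewrite mulr0.
    rewrite -[X in _ = _ * X]qx mulrDr [LHS]addrC mulr_sumr; congr (_ + _).
      apply: eq_bigr => i _; rewrite !hornerE coef_map /= exprMn rmorphM rmorphXn /=.
      have -> : (a%:~R : algC) ^+ n.-1 = a%:~R ^+ (n.-1 - i) * a%:~R ^+ i.
        by rewrite -exprD subnK // -ltnS prednK.
      ring.
    rewrite coef_map /= -[q`_n]/(lead_coef q) lq exprMn mulrA -exprSr prednK //.
exists `|a|%N; first by rewrite absz_gt0.
have -> : `|a|%N%:R = (Num.sg a)%:~R * a%:~R :> algC.
  by rewrite natr_absz {1}[`|a|]normrEsg intrM.
by rewrite -mulrA rpredM // Aint_int.
Qed.

(** * Closure properties of subfields and of their rings of integers *)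

Lemma subfield_X (K : algC -> Prop) (x : algC) (n : nat) :
  is_subfield K -> K x -> K (x ^+ n).
Proof.
move=> [_ [K1 [_ [_ [KM _]]]]] Kx.
by elim: n => [|n IHn]; rewrite ?expr0 // exprS; apply: KM.
Qed.

Lemma subfield_expz (K : algC -> Prop) (x : algC) (n : int) :
  is_subfield K -> K x -> K (x ^ n).
Proof.
move=> sK Kx; case: n => n; first exact: subfield_X.
by apply: (proj2 (proj2 (proj2 (proj2 (proj2 sK))))); apply: subfield_X.
Qed.

Lemma subfield_nat (K : algC -> Prop) (n : nat) : is_subfield K -> K n%:R.
Proof.
move=> [K0 [K1 [KD _]]].
by elim: n => [|n IHn]; rewrite ?mulr0n // mulrS; apply: KD.
Qed.

Lemma poly_over_horner (K : algC -> Prop) (p : {poly algC}) (x : algC) :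
  is_subfield K -> poly_over K p -> K x -> K p.[x].
Proof.
move=> sK Kp Kx; case: (sK) => K0 [_ [KD [_ [KM _]]]]; rewrite horner_coef.
by elim/big_ind: _ => // i _; apply: KM => //; apply: subfield_X.
Qed.

Section IntegerRing.

Variable K : algC -> Prop.
Hypothesis sK : is_subfield K.
Local Notation O := (ringOI K).

Lemma OI1 : O 1.
Proof. by case: sK => _ [K1 _]; split. Qed.

Lemma OID (x y : algC) : O x -> O y -> O (x + y).
Proof.
case: sK => _ [_ [KD _]] [Kx Ax] [Ky Ay].
by split; [apply: KD | rewrite rpredD].
Qed.

Lemma OIN (x : algC) : O x -> O (- x).
Proof.
case: sK => _ [_ [_ [KN _]]] [Kx Ax].
by split; [apply: KN | rewrite rpredN].
Qed.

Lemma OIB (x y : algC) : O x -> O y -> O (x - y).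
Proof. by move=> Ox Oy; apply: OID => //; apply: OIN. Qed.

Lemma OIM (x y : algC) : O x -> O y -> O (x * y).
Proof.
case: sK => _ [_ [_ [_ [KM _]]]] [Kx Ax] [Ky Ay].
by split; [apply: KM | rewrite rpredM].
Qed.

Lemma OIX (x : algC) (n : nat) : O x -> O (x ^+ n).
Proof. by move=> [Kx Ax]; split; [apply: subfield_X | rewrite rpredX]. Qed.

Lemma OI_nat (n : nat) : O n%:R.
Proof. by split; [apply: subfield_nat | rewrite rpred_nat]. Qed.

Lemma OI_int (n : int) : O n%:~R.
Proof.
case: n => n; first exact: OI_nat.
by rewrite NegzE rmorphN; apply/OIN/OI_nat.
Qed.

Lemma OI_sum (I : Type) (r : seq I) (F : I -> algC) :
  (forall i, O (F i)) -> O (\sum_(i <- r) F i).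
Proof.
move=> OF; elim: r => [|i r IHr]; first by rewrite big_nil; apply: (OI_nat 0).
by rewrite big_cons; apply: OID.
Qed.

Lemma OI_dvd_nat (x : algC) : O x -> x != 0 ->
  exists n : nat, (0 < n)%N /\ O (n%:R / x).
Proof.
move=> [Kx Ax] x0; have [n n0 An] := Aint_dvd_int Ax x0; exists n; split=> //.
case: (sK) => _ [_ [_ [_ [KM KV]]]].
by split=> //; apply: KM; [apply: subfield_nat | apply: KV].
Qed.

Lemma subfield_frac (x : algC) : K x ->
  exists a b : algC, [/\ O a, O b, b != 0 & x = a / b].
Proof.
move=> Kx; have [n n0 An] := Aint_scale x; have nC : n%:R != 0 :> algC by rewrite pnatr_eq0 -lt0n.
exists (n%:R * x), n%:R; split=> //; last by rewrite mulrC mulKf.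
  by case: (sK) => _ [_ [_ [_ [KM _]]]]; split=> //; apply: KM => //; apply: subfield_nat.
exact: OI_nat.
Qed.

End IntegerRing.

(** * Finiteness of the residue rings O/nO *)

(** The m by n coefficient matrix has a nonzero left kernel vector. Read as a polynomial, this
    vector is made integral and primitive by [zprimitive]. *)
Lemma primitive_int_relation (m n : nat) (s : 'I_n -> algC) (e : 'I_m -> algC) :
  (n < m)%N ->
  (forall i, exists c : 'I_n -> rat, e i = \sum_(j < n) ratr (c j) * s j) ->
  exists v : 'I_m -> int, \sum_(i < m) (v i)%:~R * e i = 0 /\
    forall d : int, (forall i, (d %| v i)%Z) -> (d %| 1)%Z.
Proof.
move=> lt_nm /fin_all_exists[C De].
pose A : 'M[rat]_(m, n) := \matrix_(i, j) C i j.
have : kermx A != 0.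
  by rewrite -mxrank_eq0 mxrank_ker -lt0n subn_gt0 (leq_ltn_trans (rank_leq_col _)).
case/rowV0Pn=> w /sub_kermxP wA w0.
have [q [a a0 Dq]] := rat_poly_scale (rVpoly w).
have aQ : a%:~R != 0 :> rat by rewrite intr_eq0.
have q0 : q != 0.
  apply: contraNneq w0 => q0; apply/eqP/(can_inj rVpolyK).
  by rewrite Dq q0 rmorph0 scaler0 linear0.
have z0 : zcontents q != 0 by rewrite zcontents_eq0.
have Dw (i : 'I_m) : w 0 i = a%:~R^-1 * (zcontents q)%:~R * ((zprimitive q)`_i)%:~R.
  by rewrite -coef_rVpoly_ord Dq coefZ coef_map /= {1}[q]zpolyEprim coefZ intrM mulrA.
exists (fun i => (zprimitive q)`_i); split=> [|d dv].
  pose u : algC := ratr (a%:~R / (zcontents q)%:~R).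
  transitivity (u * \sum_(j < n) ratr ((w *m A) 0 j) * s j); last first.
    by rewrite wA big1 ?mulr0 // => j _; rewrite mxE rmorph0 mul0r.
  have -> : \sum_(j < n) ratr ((w *m A) 0 j) * s j = \sum_(i < m) ratr (w 0 i) * e i.
    under eq_bigr => j _ do rewrite mxE rmorph_sum mulr_suml.
    rewrite exchange_big; apply: eq_bigr => i _; rewrite De mulr_sumr.
    by apply: eq_bigr => j _; rewrite mxE rmorphM mulrA.
  rewrite mulr_sumr; apply: eq_bigr => i _.
  rewrite /u mulrA -rmorphM -[in LHS]ratr_int; congr (ratr _ * _); rewrite Dw; field.
  by rewrite aQ intr_eq0.
suff: (d %| zcontents (zprimitive q))%Z by rewrite zcontents_primitive q0.
rewrite dvdz_contents; apply/polyOverP => i.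
have [lt_im | le_mi] := ltnP i m; first exact: (dv (Ordinal lt_im)).
have -> : (zprimitive q)`_i = 0; last exact: dvdz0.
apply: nth_default; rewrite size_zprimitive; apply: leq_trans le_mi.
have := size_poly m (fun k => if insub k is Some i then w 0 i else 0).
rewrite -[\poly_(_ < _) _]/(rVpoly w) Dq size_scale ?invr_eq0 //.
by rewrite (size_map_inj_poly (@intr_inj rat)).
Qed.

Section FiniteResidues.

Variable K : algC -> Prop.
Hypothesis nfK : number_field K.
Local Notation O := (ringOI K).

Let sK : is_subfield K := proj1 nfK.

(** [L] is a finite list covering the classes of O modulo nO, possibly with repetitions. *)
Definition residues (n : nat) (L : seq algC) :=
  forall x, O x -> exists2 r, r \in L & O ((x - r) / n%:R).

(* A maximal family of integers independent modulo p has at most dim_Q K members, and spans O modulo p. *)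
Lemma residues_prime (p : nat) : prime p -> exists L, residues p L.
Proof.
move=> pr_p; have p0 : p%:R != 0 :> algC by rewrite pnatr_eq0 -lt0n prime_gt0.
have pZ0 : p%:Z != 0 by rewrite -lt0n prime_gt0.
pose indep r (e : nat -> algC) := (forall i, (i < r)%N -> O (e i)) /\
  forall c : nat -> int, O ((\sum_(i < r) (c i)%:~R * e i) / p%:R) ->
  forall i, (i < r)%N -> (p%:Z %| c i)%Z.
(* Induction on r: if the combinations of r independent integers with coefficients in 0..p-1 miss a
   class, an element x of that class extends the family. *)
have step r : (exists L, residues p L) \/ exists e, indep r e.
  elim: r => [|r [|[e [Oe indep_e]]]]; [|by left|].
    by right; exists (fun _ => 0); split=> // c _ i.
  have lt_mod (z : int) : (`|(z %% p)%Z| < p)%N.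
    by rewrite -ltz_nat gez0_abs ?modz_ge0 // ltz_pmod // ltz_nat prime_gt0.
  pose comb (d : {ffun 'I_r -> 'I_p}) := \sum_(i < r) (d i)%:R * e i.
  have [resL | nres] := classic (residues p [seq comb d | d in {ffun 'I_r -> 'I_p}]).
    by left; eexists; apply: resL.
  have [x nx] := not_all_ex_not _ _ nres; have [Ox noL] := imply_to_and _ _ nx; right.
  exists (fun i => if (i < r)%N then e i else x); split=> [i _|c].
    by case: ifP => // ir; apply: Oe.
  rewrite big_ord_recr /= ltnn.
  rewrite (eq_bigr (fun i : 'I_r => (c i)%:~R * e i)); last by move=> i _; rewrite ltn_ord.
  set S := \sum_(i < r) _ => OS.
  have [p_cr | np_cr] := boolP (p%:Z %| c r)%Z.
    move=> i; rewrite ltnS leq_eqVlt => /orP[/eqP-> // | ir].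
    apply: (indep_e c) ir; rewrite -/S.
    have [q Dq] := dvdzP p_cr.
    have -> : S / p%:R = (S + (c r)%:~R * x) / p%:R - q%:~R * x by rewrite Dq intrM -pmulrn; field.
    by apply: OIB => //; apply: OIM => //; apply: OI_int.
  case: noL.
  (* Here [c r] has an inverse u modulo p, so x is congruent to -u S. Reducing the coefficients
     modulo p gives a member of the list, against the choice of x. *)
  have cop : coprimez (c r) p by rewrite coprimez_sym coprimezE prime_coprime.
  have [[u w] /= Duw] := coprimezP _ _ cop.
  pose d := [ffun i : 'I_r => Ordinal (lt_mod (- u * c i))].
  exists (comb d); first by apply/imageP; exists d.
  have Dd (i : 'I_r) : (d i)%:R * e i =
      - u%:~R * ((c i)%:~R * e i) - p%:R * ((- u * c i %/ p)%Z%:~R * e i).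
    have -> : (d i)%:R = (- u * c i)%:~R - (- u * c i %/ p)%Z%:~R * p%:R :> algC.
      rewrite ffunE /= natr_absz ger0_norm ?modz_ge0 // /modz.
      by rewrite rmorphB [X in _ - X]intrM.
    by rewrite intrM rmorphN /=; ring.
  rewrite /comb; under eq_bigr => i _ do rewrite Dd.
  rewrite sumrB -!mulr_sumr -/S; set T := \sum_(i < r) _.
  have DC : u%:~R * (c r)%:~R + w%:~R * p%:R = 1 :> algC.
    by rewrite pmulrn -!intrM -rmorphD Duw.
  have -> : (x - (- u%:~R * S - p%:R * T)) / p%:R =
      u%:~R * ((S + (c r)%:~R * x) / p%:R) + (w%:~R * x + T).
    have Dx : x = (u%:~R * (c r)%:~R + w%:~R * p%:R) * x by rewrite DC mul1r.
    by rewrite {1}Dx; field.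
  apply: OID => //; first by apply: OIM => //; apply: OI_int.
  apply: OID => //; first by apply: OIM => //; apply: OI_int.
  by apply: OI_sum => // i; apply: OIM => //; [apply: OI_int | apply: Oe].
have [n [s spanK]] := proj2 nfK.
(* K is spanned by n elements, so n + 1 independent integers satisfy a primitive relation, all of
   whose coefficients p would divide. *)
have [// | [e [Oe indep_e]]] := step n.+1.
have [i|v [v0 prim_v]] := @primitive_int_relation n.+1 n s (fun i => e i) (ltnSn n).
  by apply: spanK; case: (Oe i).
have: (p%:Z %| 1)%Z.
  apply: prim_v => i; rewrite -[i]inord_val; apply: (indep_e (fun i => v (inord i))) => //.
  under eq_bigr => j _ do rewrite inord_val.
  by rewrite v0 mul0r; apply: (OI_nat sK 0).
by rewrite dvdzE dvdn1 absz_nat => /eqP p1; rewrite p1 in pr_p.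
Qed.

(** Induction on n through a prime divisor p: the sums r + p s, with r from a list modulo p and s
    from a list modulo n/p, cover O modulo n. *)
Lemma residues_exist (n : nat) : (0 < n)%N -> exists L, residues n L.
Proof.
elim/ltn_ind: n => n IHn n0; have [n1|n1] := leqP n 1.
  have -> : n = 1%N by apply/eqP; rewrite eqn_leq n1.
  by exists [:: 0] => x Ox; exists 0; rewrite ?inE // subr0 divr1.
have pr_p := pdiv_prime n1; set p := pdiv n in pr_p.
have [L resL] := residues_prime pr_p.
have Dn : n = (n %/ p * p)%N by rewrite divnK // pdiv_dvd.
have [||L' resL'] := IHn (n %/ p)%N.
- by rewrite ltn_Pdiv // prime_gt1.
- by rewrite divn_gt0 ?prime_gt0 // dvdn_leq // pdiv_dvd.
have n'0 : (n %/ p)%:R != 0 :> algC.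
  by rewrite pnatr_eq0 -lt0n divn_gt0 ?prime_gt0 // dvdn_leq // pdiv_dvd.
have p0 : p%:R != 0 :> algC by rewrite pnatr_eq0 -lt0n prime_gt0.
exists [seq r + p%:R * s | r <- L, s <- L'] => x Ox.
have [r rL Or] := resL x Ox; have [s sL' Os] := resL' _ Or.
exists (r + p%:R * s); first exact: allpairs_f.
suff -> : (x - (r + p%:R * s)) / n%:R = ((x - r) / p%:R - s) / (n %/ p)%:R by [].
by rewrite {1}Dn natrM; field; rewrite n'0.
Qed.

(** Applied below to sequences of powers, possibly scaled: two of them agree modulo n. *)
Lemma residues_pigeonhole (n : nat) (s : nat -> algC) :
  (0 < n)%N -> (forall i, O (s i)) ->
  exists i j : nat, (i < j)%N /\ O ((s j - s i) / n%:R).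
Proof.
move=> n0 Os; have [L resL] := residues_exist n0.
have /fin_all_exists[g gP] (i : 'I_(size L).+1) :
    exists r, r \in L /\ O ((s i - r) / n%:R).
  by have [r rL Or] := resL _ (Os i); exists r.
have : ~~ injectiveb g.
  apply/negP => /injectiveP g_inj.
  have /uniq_leq_size : uniq (codom g) by rewrite map_inj_uniq ?enum_uniq.
  move=> /(_ L); rewrite size_codom card_ord ltnn => absurd.
  by apply: notF; apply: absurd => r /codomP[i ->]; case: (gP i).
have congr_ij (i j : 'I_(size L).+1) : g i = g j -> O ((s j - s i) / n%:R).
  move=> gij; have [[_ Oi] [_ Oj]] := (gP i, gP j).
  have -> : (s j - s i) / n%:R = (s j - g j) / n%:R - (s i - g i) / n%:R.
    by rewrite gij -mulrBl opprB addrA subrK.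
  exact: OIB.
case/injectivePn=> i [j ij gij].
have [lt_ij | lt_ji | eq_ij] := ltngtP i j.
- by exists i, j; split=> //; apply: congr_ij.
- by exists j, i; split=> //; apply: congr_ij.
- by case/eqP: ij; apply: val_inj.
Qed.

(** Since x divides some positive integer n, all c^i n lie in O. Two of them agree modulo n, so c^j
    - c^i is integral for some i < j, hence c is. *)
Lemma almost_integral (c x : algC) :
  K c -> O x -> x != 0 -> (forall n, O (c ^+ n * x)) -> O c.
Proof.
move=> Kc Ox x0 Ocx; have [n [n0 On]] := OI_dvd_nat sK Ox x0.
have nC : n%:R != 0 :> algC by rewrite pnatr_eq0 -lt0n.
have Ocn i : O (c ^+ i * n%:R).
  have -> : c ^+ i * n%:R = c ^+ i * x * (n%:R / x) by field.
  exact: OIM.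
have [i [j [lt_ij]]] := residues_pigeonhole n0 Ocn.
rewrite -mulrBl mulfK // => -[_ cA]; split=> //; exact: Aint_expB lt_ij cA.
Qed.

End FiniteResidues.

(** * Prime ideals and an inverse of a uniformizer *)

Section PrimeIdeal.

Variables K P : algC -> Prop.
Hypothesis nfK : number_field K.
Hypothesis prP : prime_of K P.
Local Notation O := (ringOI K).

Let sK : is_subfield K := proj1 nfK.

Lemma prime_sub (x : algC) : P x -> O x.
Proof. by case: prP => PO _; apply: PO. Qed.

Lemma prime_0 : P 0.
Proof. by case: prP => _ []. Qed.

Lemma prime_D (x y : algC) : P x -> P y -> P (x + y).
Proof. by case: prP => _ [_ [PD _]]; apply: PD. Qed.

Lemma prime_Ml (a x : algC) : O a -> P x -> P (a * x).
Proof. by case: prP => _ [_ [_ [PM _]]]; apply: PM. Qed.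

Lemma prime_B (x y : algC) : P x -> P y -> P (x - y).
Proof.
move=> Px Py; rewrite -mulN1r; apply: prime_D => //; apply: prime_Ml => //.
by apply/OIN/OI1.
Qed.

Lemma prime_not1 : ~ P 1.
Proof. by case: prP => _ [_ [_ [_ [_ []]]]]. Qed.

Lemma nprime_M (x y : algC) : O x -> O y -> ~ P x -> ~ P y -> ~ P (x * y).
Proof.
by case: prP => _ [_ [_ [_ [_ [_ prM]]]]] Ox Oy nPx nPy /prM[].
Qed.

Lemma nprime_X (x : algC) (n : nat) : O x -> ~ P x -> ~ P (x ^+ n).
Proof.
move=> Ox nPx; elim: n => [|n IHn]; first exact: prime_not1.
by rewrite exprS; apply: nprime_M => //; apply: OIX.
Qed.

Lemma nprime_neq0 (x : algC) : ~ P x -> x != 0.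
Proof. by move=> nPx; apply: contra_notN nPx => /eqP->; apply: prime_0. Qed.

Lemma prime_nat : exists2 n : nat, (0 < n)%N & P n%:R.
Proof.
case: (prP) => _ [_ [_ [_ [[x [Px x0]] _]]]].
have [n [n0 On]] := OI_dvd_nat sK (prime_sub Px) x0.
by exists n => //; rewrite -(divfK x0 n%:R); apply: prime_Ml.
Qed.

(** Two powers of u agree modulo some n in P, so u^i (1 - u^(j-i)) is in P. As u is not, 1 - u^(j-i)
    is in P, and u^(j-i-1) inverts u modulo P. *)
Lemma prime_maximal (u : algC) : O u -> ~ P u ->
  exists w z : algC, [/\ O w, P z & w * u + z = 1].
Proof.
move=> Ou nPu; have [n n0 Pn] := prime_nat.
have nC : n%:R != 0 :> algC by rewrite pnatr_eq0 -lt0n.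
have [i [j [lt_ij Oij]]] := residues_pigeonhole nfK n0 (fun i => OIX sK i Ou).
pose z := 1 - u ^+ (j - i).
have Oz : O z by apply: OIB => //; [apply: OI1 | apply: OIX].
exists (u ^+ (j - i).-1), z; split; first exact: OIX.
  apply: NNPP => nPz; case: (nprime_M (OIX sK i Ou) Oz (nprime_X (n := i) Ou nPu) nPz).
  have -> : u ^+ i * z = (-1 * ((u ^+ j - u ^+ i) / n%:R)) * n%:R.
    by rewrite -(subnKC (ltnW lt_ij)) exprD /z; field.
  by apply: prime_Ml => //; apply: OIM => //; apply/OIN/OI1.
by rewrite -exprSr prednK ?subn_gt0 // addrC subrK.
Qed.

(* [b] stays nonzero in the localization of O/nO at P while it is multiplied by elements so as to kill P. *)
Lemma prime_annihilator (n : nat) : (0 < n)%N -> P n%:R ->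
  exists b : algC, [/\ O b, ~ O (b / n%:R) & forall x, P x -> O (b * x / n%:R)].
Proof.
move=> n0 Pn; have nC : n%:R != 0 :> algC by rewrite pnatr_eq0 -lt0n.
have [L resL] := residues_exist nfK n0.
pose inv b := forall s, O s -> ~ P s -> ~ O (s * b / n%:R).
suff [b [Ob inv_b bL]] : exists b, [/\ O b, inv b &
    forall r, r \in L -> P r -> O (b * r / n%:R)].
  exists b; split=> //.
    by have := inv_b 1 (OI1 sK) prime_not1; rewrite mul1r.
  move=> x Px; have [r rL Or] := resL x (prime_sub Px).
  have Pr : P r.
    have -> : r = x - (x - r) / n%:R * n%:R by field.
    by apply: prime_B => //; apply: prime_Ml.
  have -> : b * x / n%:R = b * r / n%:R + b * ((x - r) / n%:R) by field.
  by apply: OID => //; [apply: bL | apply: OIM].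
elim: L {resL} => [|x L [b [Ob inv_b bL]]].
  exists 1; split=> //; first exact: OI1.
  move=> s Os nPs Osn; apply: nPs; rewrite mulr1 in Osn.
  by rewrite -(divfK nC s); apply: prime_Ml.
have [Px | nPx] := classic (P x); last first.
  by exists b; split=> // r; rewrite inE => /predU1P[-> | rL] //; apply: bL.
have Ox := prime_sub Px.
(* Exponent 0 keeps b nonzero in the localization. Some exponent i does not: x^i (1 - x^(j-i)) is in
   nO, and 1 - x^(j-i) is outside P because x is in P. *)
have [k [inv_k ninv_k]] : exists k, inv (b * x ^+ k) /\ ~ inv (b * x ^+ k.+1).
  have [i [j [lt_ij Oij]]] := residues_pigeonhole nfK n0 (fun i => OIX sK i Ox).
  have ninv_i : ~ inv (b * x ^+ i).
    pose w := 1 - x ^+ (j - i).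
    have Ow : O w by apply: OIB => //; [apply: OI1 | apply: OIX].
    move/(_ w Ow); apply.
      move=> Pw; apply: prime_not1; rewrite -(subrK (x ^+ (j - i)) 1).
      apply: prime_D => //; rewrite -(prednK (n := j - i)) ?subn_gt0 // exprSr.
      by apply: prime_Ml => //; apply: OIX.
    have -> : w * (b * x ^+ i) / n%:R = - b * ((x ^+ j - x ^+ i) / n%:R).
      by rewrite -(subnKC (ltnW lt_ij)) exprD /w; field.
    by apply: OIM => //; apply: OIN.
  elim: i ninv_i {Oij lt_ij} => [|i IHi] ninv_i; first by rewrite expr0 mulr1 in ninv_i.
  by have [inv_i|/IHi//] := classic (inv (b * x ^+ i)); exists i.
have [s ns] := not_all_ex_not _ _ ninv_k.
have [Os ns'] := imply_to_and _ _ ns; have [nPs /NNPP Osb] := imply_to_and _ _ ns'.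
(* The factor s outside P witnesses that b x^(k+1) vanishes in the localization; including it makes
   the product kill x in O/nO itself. *)
exists (s * (b * x ^+ k)); split.
- by apply: OIM => //; apply: OIM => //; apply: OIX.
- move=> s' Os' nPs'; rewrite mulrA; apply: inv_k; first exact: OIM.
  exact: nprime_M.
move=> r; rewrite inE => /predU1P[-> _ | rL Pr].
  have -> : s * (b * x ^+ k) * x / n%:R = s * (b * x ^+ k.+1) / n%:R by rewrite exprSr; ring.
  exact: Osb.
have -> : s * (b * x ^+ k) * r / n%:R = s * x ^+ k * (b * r / n%:R) by ring.
by apply: OIM => //; [apply: OIM => //; apply: OIX | apply: bL].
Qed.

(** Take c = b/n with b from [prime_annihilator]. If cP were inside P, all c^i n would lie in P, so
    c would be integral, contrary to the choice of b. *)
Lemma inverse_uniformizer : exists c pi : algC,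
  [/\ K c, forall x, P x -> O (c * x), P pi & ~ P (c * pi)].
Proof.
have [n n0 Pn] := prime_nat; have [b [Ob nOb bP]] := prime_annihilator n0 Pn.
have Kc : K (b / n%:R).
  case: (sK) => _ [_ [_ [_ [KM KV]]]]; apply: KM; first by case: Ob.
  by apply: KV; apply: subfield_nat.
have cP x : P x -> O (b / n%:R * x) by rewrite mulrAC; apply: bP.
apply: NNPP => none; apply: nOb.
apply: (almost_integral nfK Kc (prime_sub Pn)) => [|i].
  by rewrite pnatr_eq0 -lt0n.
apply: prime_sub; elim: i => [|i IHi]; first by rewrite mul1r.
apply: NNPP => nPi; apply: none; exists (b / n%:R), ((b / n%:R) ^+ i * n%:R).
by split=> //; rewrite mulrA -exprS.
Qed.

End PrimeIdeal.

(** * Localization at P and the valuation read off from c *)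

Definition local_int (K P : algC -> Prop) (x : algC) : Prop :=
  exists a b : algC, [/\ ringOI K a, ringOI K b, ~ P b & x = a / b].

Definition local_unit (K P : algC -> Prop) (x : algC) : Prop :=
  exists a b : algC, [/\ ringOI K a, ringOI K b, ~ P a, ~ P b & x = a / b].

Section Valuation.

Variables K P : algC -> Prop.
Hypothesis nfK : number_field K.
Hypothesis prP : prime_of K P.
Local Notation O := (ringOI K).

Let sK : is_subfield K := proj1 nfK.

Variables c pi : algC.
Hypothesis Kc : K c.
Hypothesis cP : forall x, P x -> O (c * x).
Hypothesis Ppi : P pi.
Hypothesis nPcpi : ~ P (c * pi).

Let Ocpi : O (c * pi) := cP Ppi.

Let nprime0 := nprime_neq0 prP.

Lemma inv_unif_neq0 : c != 0.
Proof. by apply: contra_notN nPcpi => /eqP->; rewrite mul0r; apply: prime_0 prP. Qed.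

(** If x were outside P, so would be (c pi)^(n+1) x; but this is pi times the integer pi^n (c^(n+1)
    x). *)
Lemma prime_of_mul_exp (x : algC) (n : nat) : O x -> O (c ^+ n.+1 * x) -> P x.
Proof.
move=> Ox Ocx; apply: NNPP => nPx.
apply: (nprime_M prP (OIX sK n.+1 Ocpi) Ox (nprime_X nfK prP (n := n.+1) Ocpi nPcpi) nPx).
have -> : (c * pi) ^+ n.+1 * x = (pi ^+ n * (c ^+ n.+1 * x)) * pi.
  by rewrite exprMn (exprSr pi); ring.
apply: prime_Ml prP _ _ _ Ppi; apply: OIM => //; apply: OIX => //.
exact: prime_sub prP _ Ppi.
Qed.

(** Climb from exponent 0: if c^j x is in O and j <= n, integrality of c^(n+1) x puts c^j x in P, so
    c^(j+1) x is in O. *)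
Lemma OI_mul_exp_pred (x : algC) (n : nat) : O x -> O (c ^+ n.+1 * x) -> O (c ^+ n * x).
Proof.
move=> Ox Ocx; suff: forall j, (j <= n)%N -> O (c ^+ j * x) by apply.
elim=> [|j IHj] lt_jn; first by rewrite mul1r.
rewrite exprS -mulrA; apply: cP; apply: (@prime_of_mul_exp _ (n - j)).
  exact/IHj/ltnW.
by rewrite mulrA -exprD addSn subnK // ltnW.
Qed.

Lemma ipowP (n : nat) (x : algC) : ipow K P n x <-> O x /\ O (c ^+ n * x).
Proof.
split; elim: n x => [|n IHn] x /=.
- by rewrite mul1r.
- case=> s [sP ->]; elim: s sP => [|[a b] s IHs] sP.
    by rewrite big_nil mulr0; split; apply: (OI_nat sK 0).
  have [|Os Ocs] := IHs.
    by move=> ab abs; apply: sP; rewrite inE abs orbT.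
  have [|Pa /IHn[Ob Ocb]] := sP (a, b); first by rewrite inE eqxx.
  rewrite big_cons; split.
    by apply: OID => //; apply: OIM => //; apply: prime_sub Pa.
  rewrite mulrDr; apply: OID => //=.
  have -> : c ^+ n.+1 * (a * b) = c * a * (c ^+ n * b) by rewrite exprS; ring.
  by apply: OIM => //; apply: cP.
- by case.
case=> Ox Ocx; have Px := prime_of_mul_exp Ox Ocx.
(* From w c pi + z = 1 comes x = pi (w c x) + z x, where pi and z are in P while w c x and x are in
   P^n by induction. *)
have [w [z [Ow Pz wz1]]] := prime_maximal nfK prP Ocpi nPcpi.
exists [:: (pi, w * (c * x)); (z, x)]; split.
  move=> ab; rewrite !inE => /pred2P[] -> /=; split=> //; apply: IHn.
    split; first by apply: OIM => //; apply: cP.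
    have -> : c ^+ n * (w * (c * x)) = w * (c ^+ n.+1 * x) by rewrite exprSr; ring.
    exact: OIM.
  by split=> //; apply: OI_mul_exp_pred.
rewrite big_cons big_seq1 /=.
transitivity ((w * (c * pi) + z) * x); first by rewrite wz1 mul1r.
ring.
Qed.

(** An integer y lies in P exactly when c y is an integer; apply this to y = c^n x. *)
Lemma ipow_exact (n : nat) (x : algC) :
  (ipow K P n x /\ ~ ipow K P n.+1 x) <-> [/\ O x, O (c ^+ n * x) & ~ P (c ^+ n * x)].
Proof.
rewrite !ipowP; split=> [[[Ox Ocx] nOcx] | [Ox Ocx nPcx]]; split=> //.
  by move=> Pcx; apply: nOcx; split=> //; rewrite exprS -mulrA; apply: cP.
move=> [_ OcSx]; apply: nPcx; apply: (@prime_of_mul_exp _ 0) => //.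
by rewrite expr1 mulrA -exprS.
Qed.

(** Were every c^n x integral, c would be too, and c pi would lie in P. So integrality stops at some
    exponent. *)
Lemma ipow_exact_exists (x : algC) : O x -> x != 0 ->
  exists n : nat, O (c ^+ n * x) /\ ~ P (c ^+ n * x).
Proof.
move=> Ox x0.
have [n nOn] : exists n, ~ O (c ^+ n * x).
  apply: not_all_ex_not => Oall.
  exact: nPcpi (prime_Ml prP (almost_integral nfK Kc Ox x0 Oall) Ppi).
elim: n nOn => [|n IHn] nOn; first by rewrite mul1r in nOn.
have [On | /IHn//] := classic (O (c ^+ n * x)).
exists n; split=> // Pn; apply: nOn; rewrite exprS -mulrA; exact: cP.
Qed.

Local Notation loc := (local_int K P).
Local Notation locu := (local_unit K P).

Lemma local_unit_int (x : algC) : locu x -> loc x.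
Proof. by move=> [a [b [Oa Ob _ nPb ->]]]; exists a, b. Qed.

Lemma local_unit_neq0 (x : algC) : locu x -> x != 0.
Proof.
by move=> [a [b [_ _ nPa nPb ->]]]; rewrite mulf_neq0 ?invr_eq0 ?nprime0.
Qed.

Lemma local_unitM (x y : algC) : locu x -> locu y -> locu (x * y).
Proof.
move=> [a [b [Oa Ob nPa nPb ->]]] [a' [b' [Oa' Ob' nPa' nPb' ->]]].
exists (a * a'), (b * b'); split; try exact: OIM; try exact: (nprime_M prP).
by rewrite invfM; ring.
Qed.

Lemma local_unitV (x : algC) : locu x -> locu x^-1.
Proof. by move=> [a [b [Oa Ob nPa nPb ->]]]; exists b, a; rewrite invf_div. Qed.

Lemma local_unit_expz (x : algC) (n : int) : locu x -> locu (x ^ n).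
Proof.
have natP k y : locu y -> locu (y ^+ k).
  move=> uy; elim: k => [|k IHk]; last by rewrite exprS; apply: local_unitM.
  have [O1 nP1] := (OI1 sK, prime_not1 prP).
  by exists 1, 1; rewrite divr1.
by move=> ux; case: n => n; [|apply: local_unitV]; apply: natP.
Qed.

Lemma local_intM (x y : algC) : loc x -> loc y -> loc (x * y).
Proof.
move=> [a [b [Oa Ob nPb ->]]] [a' [b' [Oa' Ob' nPb' ->]]].
exists (a * a'), (b * b'); split; try exact: OIM; try exact: (nprime_M prP).
by rewrite invfM; ring.
Qed.

Lemma local_intD (x y : algC) : loc x -> loc y -> loc (x + y).
Proof.
move=> [a [b [Oa Ob nPb ->]]] [a' [b' [Oa' Ob' nPb' ->]]].
exists (a * b' + a' * b), (b * b'); split; try exact: OIM; try exact: (nprime_M prP).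
  by apply: OID => //; apply: OIM.
by field; rewrite !nprime0.
Qed.

Lemma inv_unifE : c^-1 = pi / (c * pi).
Proof.
have := nprime0 nPcpi; rewrite mulf_eq0 negb_or => /andP[c0 pi0].
by rewrite invfM mulrCA mulfV ?mulr1.
Qed.

Lemma local_int_expVn (n : nat) : loc (c ^- n).
Proof.
exists (pi ^+ n), ((c * pi) ^+ n); split.
- by apply: OIX => //; apply: prime_sub Ppi.
- exact: OIX.
- exact: (nprime_X nfK prP).
by rewrite -exprVn inv_unifE expr_div_n.
Qed.

(** This makes orders unique. For k > 0, an equation c^k (a/b) = a'/b' makes c^k (a b') = a' b
    integral, which forces a b' into P. *)
Lemma local_unit_exp0 (x : algC) (n : int) : locu x -> locu (c ^ n * x) -> n = 0.
Proof.
(* A negative exponent becomes positive when the two units x and c^n x are exchanged. *)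
wlog [k ->] : x n / exists k : nat, n = k%:Z => [th|].
  case: n => k ux ucx; first by apply: (th x) => //; exists k.
  suff: - (Negz k) = 0 by move/eqP; rewrite oppr_eq0 => /eqP.
  apply: (th (c ^ (Negz k) * x)) => //; first by exists k.+1; rewrite NegzE opprK.
  by rewrite mulrA -expfzDr ?inv_unif_neq0 // addNr mul1r.
case: k => // k [a [b [Oa Ob nPa nPb ->]]] [a' [b' [Oa' Ob' nPa' nPb' Dab]]].
case: (nprime_M prP Oa Ob' nPa nPb'); apply: (@prime_of_mul_exp _ k).
  exact: OIM.
have b0 := nprime0 nPb; have b'0 := nprime0 nPb'.
have -> : c ^+ k.+1 * (a * b') = a' * b.
  have -> : a' = c ^+ k.+1 * (a / b) * b' by rewrite -[c ^+ _]/(c ^ k.+1%:Z) Dab divfK.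
  by field.
exact: OIM.
Qed.

(** This replaces the chosen fraction in [ord_is] by a condition on x alone. Conversely, any
    fraction for x has some order, which [local_unit_exp0] identifies with m. *)
Lemma ord_isP (x : algC) (m : int) : ord_is K P x m <-> locu (c ^ m * x).
Proof.
have c0 := inv_unif_neq0.
have ord_locu a b na nb : O (c ^+ na * a) -> ~ P (c ^+ na * a) ->
    O (c ^+ nb * b) -> ~ P (c ^+ nb * b) -> locu (c ^ (na%:Z - nb%:Z) * (a / b)).
  move=> Oa nPa Ob nPb; exists (c ^+ na * a), (c ^+ nb * b); split=> //.
  by rewrite expfzDr // -invr_expz -!exprnP; field; rewrite expf_neq0 // (contraNneq _ (nprime0 nPb)) // => ->; rewrite mulr0.
split=> [[x0 [a [b [na [nb]]]]] | ux].
  move=> [Oa [Ob [a0 [b0 [-> [/ipow_exact[_ Oca nPca]]]]]]].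
  by move=> [/ipow_exact[_ Ocb nPcb] ->]; apply: ord_locu.
have x0 : x != 0.
  by apply: contraNneq (local_unit_neq0 ux) => ->; rewrite mulr0.
have Kx : K x.
  case: (sK) => _ [_ [_ [_ [KM KV]]]].
  have -> : x = (c ^ m)^-1 * (c ^ m * x) by rewrite mulKf // expfz_neq0.
  have [a [b [[Ka _] [Kb _] _ _ ->]]] := ux.
  by apply: (KM); [apply: (KV); apply: subfield_expz | apply: (KM) => //; apply: (KV)].
have [a [b [Oa Ob b0 Dx]]] := subfield_frac sK Kx.
have a0 : a != 0 by apply: contraNneq x0 => a0; rewrite Dx a0 mul0r.
have [na [Oca nPca]] := ipow_exact_exists Oa a0.
have [nb [Ocb nPcb]] := ipow_exact_exists Ob b0.
split=> //; exists a, b, na, nb; do 5!split=> //.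
split; first exact/ipow_exact.
split; first exact/ipow_exact.
apply/eqP; rewrite -subr_eq0; apply/eqP.
apply: (@local_unit_exp0 (c ^ (na%:Z - nb%:Z) * x)).
  by rewrite Dx; apply: ord_locu.
by rewrite mulrA -expfzDr // subrK.
Qed.

Lemma ord_is_exists (x : algC) : K x -> x != 0 -> exists m, ord_is K P x m.
Proof.
move=> Kx x0; have [a [b [Oa Ob b0 Dx]]] := subfield_frac sK Kx.
have a0 : a != 0 by apply: contraNneq x0 => a0; rewrite Dx a0 mul0r.
have [na [Oca nPca]] := ipow_exact_exists Oa a0.
have [nb [Ocb nPcb]] := ipow_exact_exists Ob b0.
exists (na%:Z - nb%:Z); split=> //; exists a, b, na, nb; do 5!split=> //.
by split; [apply/ipow_exact | split; first exact/ipow_exact].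
Qed.

Lemma ord_is_uniq (x : algC) (m n : int) : ord_is K P x m -> ord_is K P x n -> m = n.
Proof.
move=> /ord_isP um /ord_isP un; apply/eqP; rewrite -subr_eq0; apply/eqP.
apply: (local_unit_exp0 un).
by rewrite mulrA -expfzDr ?inv_unif_neq0 // subrK.
Qed.

Lemma ord_isM (x y : algC) (m n : int) :
  ord_is K P x m -> ord_is K P y n -> ord_is K P (x * y) (m + n).
Proof.
move=> /ord_isP ux /ord_isP uy; apply/ord_isP.
by rewrite expfzDr ?inv_unif_neq0 // mulrACA; apply: local_unitM.
Qed.

Lemma ord_is_unit (x : algC) : O x -> ~ P x -> ord_is K P x 0.
Proof.
move=> Ox nPx; apply/ord_isP; rewrite mul1r; exists x, 1; rewrite divr1.
by split=> //; [apply: OI1 | apply: prime_not1 prP].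
Qed.

(** Lower bound m for the order, also meaningful at x = 0, where [ord_is] never holds. *)
Definition ord_ge (x : algC) (m : int) : Prop := loc (c ^ m * x).

Lemma ord_ge_le (x : algC) (m n : int) : n <= m -> ord_ge x m -> ord_ge x n.
Proof.
move=> le_nm gx; rewrite /ord_ge.
have -> : c ^ n * x = c ^- `|m - n|%N * (c ^ m * x).
  rewrite exprnP invr_expz mulrA -expfzDr ?inv_unif_neq0 //.
  by rewrite gez0_abs ?subr_ge0 // opprB subrK.
by apply: local_intM => //; apply: local_int_expVn.
Qed.

Lemma ord_is_ge (x : algC) (m : int) : ord_is K P x m -> ord_ge x m.
Proof. by move=> /ord_isP/local_unit_int. Qed.

Lemma ord_ge0 (m : int) : ord_ge 0 m.
Proof.
rewrite /ord_ge mulr0; exists 0, 1; rewrite mul0r.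
by split=> //; [apply: (OI_nat sK 0) | apply: OI1 | apply: prime_not1 prP].
Qed.

Lemma ord_geD (x y : algC) (m : int) : ord_ge x m -> ord_ge y m -> ord_ge (x + y) m.
Proof. by rewrite /ord_ge mulrDr; apply: local_intD. Qed.

Lemma ord_geM (x y : algC) (m n : int) :
  ord_ge x m -> ord_ge y n -> ord_ge (x * y) (m + n).
Proof.
by rewrite /ord_ge expfzDr ?inv_unif_neq0 // mulrACA; apply: local_intM.
Qed.

Lemma ord_ge_exists (x : algC) : K x -> exists m, ord_ge x m.
Proof.
move=> Kx; have [->|x0] := eqVneq x 0; first by exists 0; apply: ord_ge0.
by have [m xm] := ord_is_exists Kx x0; exists m; apply: ord_is_ge.
Qed.

(** As c^-1 = pi/(c pi), the bound on y makes c^m y a local integer times pi/(c pi). Over a common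
    denominator, c^m (x + y) has as numerator an element outside P plus one in P. *)
Lemma ord_isD (x y : algC) (m : int) :
  ord_is K P x m -> ord_ge y (m + 1) -> ord_is K P (x + y) m.
Proof.
move=> /ord_isP[a [b [Oa Ob nPa nPb Dx]]] [a' [b' [Oa' Ob' nPb' Dy]]].
apply/ord_isP; have c0 := inv_unif_neq0.
have Dcy : c ^ m * y = pi / (c * pi) * (a' / b').
  by rewrite -inv_unifE -Dy addrC expfzDr // expr1z -mulrA mulKf.
exists (a * (c * pi) * b' + a' * b * pi), (b * (c * pi) * b').
have O1 : O (a * (c * pi) * b') by do 2?apply: OIM.
have O2 : P (a' * b * pi) by apply: prime_Ml prP _ _ _ Ppi; apply: OIM.
split.
- by apply: OID => //; apply: prime_sub O2.
- by do 2?apply: OIM.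
- move=> Psum; have := prime_B nfK prP Psum O2; rewrite addrK.
  by do 2?[apply: nprime_M prP _ _ _ _ _ _ => //; try exact: OIM].
- by do 2?[apply: nprime_M prP _ _ _ _ _ _ => //; try exact: OIM].
rewrite mulrDr Dx Dcy; have := nprime0 nPcpi; rewrite mulf_eq0 negb_or => /andP[_ pi0].
by field; rewrite (nprime0 nPb) (nprime0 nPb') c0 pi0.
Qed.

(** Horner induction: if h is the difference quotient of q, that of q X + a is h t + q(s). Its order
    is bounded below uniformly, since t = (t - s) + s. *)
Lemma poly_ord_continuous (f : {poly algC}) (s : algC) :
  poly_over K f -> K s ->
  exists B : int, forall t, ord_ge (t - s) 0 ->
    exists2 h, f.[t] - f.[s] = (t - s) * h & ord_ge h B.
Proof.
move=> Kf Ks; elim/poly_ind: f Kf => [|q a IHq] Kf.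
  by exists 0 => t _; exists 0; rewrite ?horner0 ?mulr0 ?subrr //; apply: ord_ge0.
have Kq : poly_over K q.
  by move=> i; have := Kf i.+1; rewrite coefD coefMX coefC addr0.
have [B hB] := IHq Kq.
have Kqs : K q.[s] by apply: poly_over_horner.
have [B1 gs] := ord_ge_exists Ks; have [B2 gqs] := ord_ge_exists Kqs.
pose B1' := Num.min B1 0.
exists (Num.min (B + B1') B2) => t gt; have [h Dh gh] := hB t gt.
exists (h * t + q.[s]).
  by rewrite !hornerE; transitivity ((q.[t] - q.[s]) * t + (t - s) * q.[s]); [|rewrite Dh]; ring.
have gt' : ord_ge t B1'.
  rewrite -(subrK s t); apply: ord_geD.
    by apply: ord_ge_le gt; rewrite ge_min lexx orbT.
  by apply: ord_ge_le gs; rewrite ge_min lexx.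
apply: ord_geD.
  by apply: ord_ge_le (ord_geM gh gt'); rewrite ge_min lexx.
by apply: ord_ge_le gqs; rewrite ge_min lexx orbT.
Qed.

End Valuation.

(** * Adjoining a square root *)

Lemma adjoin_subfield (F : algC -> Prop) (y : algC) : is_subfield (adjoin F y).
Proof.
split; first by move=> G [G0 _] _ _.
split; first by move=> G [_ [G1 _]] _ _.
split; first by move=> u v Fu Fv G sG FG Gy; case: (sG) => _ [_ [GD _]]; apply: GD; [apply: Fu | apply: Fv].
split; first by move=> u Fu G sG FG Gy; case: (sG) => _ [_ [_ [GN _]]]; apply: GN; apply: Fu.
split; first by move=> u v Fu Fv G sG FG Gy; case: (sG) => _ [_ [_ [_ [GM _]]]]; apply: GM; [apply: Fu | apply: Fv].
by move=> u Fu G sG FG Gy; case: (sG) => _ [_ [_ [_ [_ GV]]]]; apply: GV; apply: Fu.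
Qed.

Lemma adjoin_sub (F : algC -> Prop) (y x : algC) : F x -> adjoin F y x.
Proof. by move=> Fx G _ FG _; apply: FG. Qed.


(** The elements a + b y form a subfield containing F and y; inverses come from the conjugate a - b
    y and the norm. *)
Lemma adjoin_sqrt (F : algC -> Prop) (y z : algC) :
  is_subfield F -> F (y ^+ 2) -> adjoin F y z ->
  exists a b : algC, [/\ F a, F b & z = a + b * y].
Proof.
move=> sF Fy2 Lz.
apply: (Lz (fun z => exists a b, [/\ F a, F b & z = a + b * y])); last first.
- by case: sF => F0 [F1 _]; exists 0, 1; split=> //; rewrite add0r mul1r.
- by case: sF => F0 _ x Fx; exists x, 0; split=> //; rewrite mul0r addr0.
case: sF => F0 [F1 [FD [FN [FM FV]]]].
split; first by exists 0, 0; split=> //; rewrite mul0r addr0.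
split; first by exists 1, 0; split=> //; rewrite mul0r addr0.
split.
  move=> _ _ [a [b [Fa Fb ->]]] [a' [b' [Fa' Fb' ->]]].
  by exists (a + a'), (b + b'); split; [apply: FD | apply: FD | ring].
split.
  move=> _ [a [b [Fa Fb ->]]].
  by exists (- a), (- b); split; [apply: FN | apply: FN | ring].
split.
  move=> _ _ [a [b [Fa Fb ->]]] [a' [b' [Fa' Fb' ->]]].
  exists (a * a' + b * b' * y ^+ 2), (a * b' + b * a'); split; last by ring.
    by apply: (FD); apply: (FM) => //; apply: (FM).
  by apply: (FD); apply: (FM).
move=> _ [a [b [Fa Fb ->]]].
(* A zero conjugate makes the norm vanish, but then b y = a and the element is 2a, already in F. *)
have [n0 | n0] := eqVneq (a - b * y) 0.
  have -> : b * y = a by apply/esym/eqP; rewrite -subr_eq0 n0.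
  by exists (a + a)^-1, 0; split; [apply/FV/FD | | rewrite mul0r addr0].
have [p0 | p0] := eqVneq (a + b * y) 0.
  by exists 0, 0; split=> //; rewrite p0 invr0 mul0r addr0.
pose N := a * a - b * b * y ^+ 2.
have DN : N = (a + b * y) * (a - b * y) by rewrite /N; ring.
have FN' : F N^-1.
  apply: (FV); apply: (FD); first exact: FM.
  by apply: (FN); apply: (FM) => //; apply: (FM).
exists (a / N), (- b / N); split; try by apply: (FM) => //; apply: (FN).
by rewrite DN; field; rewrite p0 n0.
Qed.

Lemma number_field_adjoin_sqrt (F : algC -> Prop) (y : algC) :
  number_field F -> F (y ^+ 2) -> number_field (adjoin F y).
Proof.
move=> [sF [n [s spanF]]] Fy2; split; first exact: adjoin_subfield.
exists (n + n)%N, (fun i => match split i with inl j => s j | inr j => s j * y end).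
move=> _ /(adjoin_sqrt sF Fy2)[a [b [Fa Fb ->]]].
have [[u Du] [v Dv]] := (spanF a Fa, spanF b Fb).
exists (fun i => match split i with inl j => u j | inr j => v j end).
rewrite big_split_ord /= Du Dv mulr_suml; congr (_ + _); apply: eq_bigr => i _.
  by rewrite (unsplitK (inl i)).
by rewrite (unsplitK (inr i)) mulrA.
Qed.

(** * Divisibility by 3 and the theorem *)

(** Here a, b, w are the orders of y - z, y + z, 2y. If a = b then 3 divides 2a; otherwise the
    smaller of a and b is w, a multiple of 3, and so is the other. *)
Lemma dvd3_of_sum_min (a b w m : int) :
  2 * w = 3 * m -> (3 %| a + b)%Z -> (a < b -> w = a) -> (b < a -> w = b) -> (3 %| a)%Z.
Proof. by move=> *; lia. Qed.

(* The two factors of -x^3 sum to 2y, so either their orders agree or the smaller one is the order of y. *)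
Lemma ord_factor_dvd3 (K P : algC -> Prop) (x y z : algC) (m : int) :
  number_field K -> prime_of K P -> ~ P 2%:R ->
  K x -> K y -> K z -> y != 0 -> y != z ->
  (y - z) * (y + z) = - x ^+ 3 -> ord_is K P (y ^+ 2) (3 * m) ->
  exists n : int, ord_is K P (y - z) n /\ (3 %| n)%Z.
Proof.
move=> nfK prP nP2 Kx Ky Kz y0 yz Dx ord_y2.
have [c [pi [Kc cP Ppi nPcpi]]] := inverse_uniformizer nfK prP.
have sK := proj1 nfK; case: (sK) => _ [_ [KD [KN _]]].
have ordM := ord_isM nfK prP Kc cP Ppi nPcpi.
have ordU := ord_is_uniq nfK prP Kc cP Ppi nPcpi.
have ordE := ord_is_exists nfK prP Kc cP Ppi nPcpi.
have ordD u v i j : ord_is K P u i -> ord_is K P v j -> i < j -> ord_is K P (u + v) i.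
  move=> ui vj ij; apply: (ord_isD nfK prP Kc cP Ppi nPcpi) => //.
  apply: (ord_ge_le nfK prP cP Ppi nPcpi _ (ord_is_ge nfK prP Kc cP Ppi nPcpi vj)).
  by rewrite lezD1.
have ord2 : ord_is K P 2%:R 0.
  by apply: (ord_is_unit nfK prP Kc cP Ppi nPcpi) => //; apply: OI_nat.
have [w ord_y] := ordE y Ky y0.
have Dw : 2 * w = 3 * m.
  by apply: ordU ord_y2; rewrite expr2 (_ : 2 * w = w + w); [apply: ordM | ring].
have ord_2y : ord_is K P (2%:R * y) w by rewrite -[w]add0r; apply: ordM.
have sumE : (y - z) + (y + z) = 2%:R * y by ring.
have [a ord_a] : exists a, ord_is K P (y - z) a.
  by apply: ordE; [apply: KD => //; apply: KN | rewrite subr_eq0].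
exists a; split=> //.
(* If y + z = 0 it has no order; then y - z = 2y, of order w. *)
have [yz0 | yz0] := eqVneq (y + z) 0.
  have Dwa : w = a by apply: ordU ord_2y _; rewrite -sumE yz0 addr0.
  by move: Dw; rewrite Dwa; lia.
have [b ord_b] : exists b, ord_is K P (y + z) b by apply: ordE => //; apply: KD.
have x0 : x != 0.
  apply: contraNneq yz => x0; move/eqP: Dx.
  by rewrite x0 expr0n oppr0 mulf_eq0 (negPf yz0) orbF subr_eq0.
have [q ord_q] := ordE x Kx x0.
have ordN1 : ord_is K P (-1) 0.
  apply: (ord_is_unit nfK prP Kc cP Ppi nPcpi); first by apply/OIN/OI1.
  move=> PN1; apply: (prime_not1 prP); rewrite -[1]opprK -mulN1r.
  by apply: (prime_Ml prP) => //; apply/OIN/OI1.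
have ab3 : a + b = 3 * q.
  apply: ordU (ordM _ _ _ _ ord_a ord_b) _; rewrite Dx -mulN1r !exprS expr0 mulr1.
  rewrite (_ : 3 * q = 0 + (q + (q + q))); last by ring.
  by apply: (ordM) => //; apply: (ordM) => //; apply: ordM.
apply: (@dvd3_of_sum_min a b _ _ Dw) => [|ab|ba].
- by rewrite ab3 dvdz_mulr.
- by apply: ordU ord_2y _; rewrite -sumE; apply: ordD ab.
- by apply: ordU ord_2y _; rewrite -sumE addrC; apply: ordD ba.
Qed.

(** Write x as (c^(-m))^d times a P-unit a/b. The latter is a Q-unit because Q meets O_K in P, so n
    is the Q-order of c^(-m). *)
Lemma ord_dvd_above (K P L Q : algC -> Prop) (x : algC) (d m : int) :
  number_field K -> prime_of K P -> number_field L -> prime_of L Q ->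
  (forall z, K z -> L z) -> (forall z, ringOI K z -> (Q z <-> P z)) ->
  ord_is K P x (d * m) -> exists n : int, ord_is L Q x (d * n).
Proof.
move=> nfK prP nfL prQ KL QP.
have [c [pi [Kc cP Ppi nPcpi]]] := inverse_uniformizer nfK prP.
have [e [rho [Le eQ Qrho nQerho]]] := inverse_uniformizer nfL prQ.
have c0 := inv_unif_neq0 prP nPcpi; have e0 := inv_unif_neq0 prQ nQerho.
move=> /(ord_isP nfK prP Kc cP Ppi nPcpi)[a [b [Oa Ob nPa nPb Dx]]].
have OL z : ringOI K z -> ringOI L z by case=> Kz Az; split=> //; apply: KL.
have cm0 : c ^ (- m) != 0 by apply: expfz_neq0.
have Lcm : L (c ^ (- m)) by apply: KL; apply: subfield_expz => //; case: nfK.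
have [n /(ord_isP nfL prQ Le eQ Qrho nQerho) un] :=
  ord_is_exists nfL prQ Le eQ Qrho nQerho Lcm cm0.
exists n; apply/(ord_isP nfL prQ Le eQ Qrho nQerho).
have -> : e ^ (d * n) * x = (e ^ n * c ^ (- m)) ^ d * (a / b).
  rewrite -Dx expfzMl !exprz_exp [n * d]mulrC [RHS]mulrA -[e ^ _ * _ * _]mulrA -expfzDr //.
  by rewrite mulNr [m * d]mulrC addNr mulr1.
apply: (local_unitM nfL prQ); first exact: (local_unit_expz nfL prQ).
by exists a, b; split=> //; try exact: OL; rewrite QP.
Qed.

Unset Implicit Arguments.

(* X0 = aX / bX and Y0 = cY / dY in reduced form, as elements of k(t). *)
Theorem theorem3p2 (k : algC -> Prop) (f aX bX cY dY : {poly algC})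
  (P : algC -> Prop) (tp : algC) :
  number_field k ->
  poly_over k f -> (1 < size f)%N ->
  poly_over k aX -> poly_over k bX -> poly_over k cY -> poly_over k dY ->
  bX != 0 -> dY != 0 -> coprimep aX bX -> coprimep cY dY ->
  cY ^+ 2 * bX ^+ 3 = (aX ^+ 3 + f * bX ^+ 3) * dY ^+ 2 ->
  prime_of k P -> ~ P 2%:R ->
  k tp -> f.[tp] != 0 ->
  (exists m : int, ord_is k P f.[tp] m /\ (3 %| m)%Z) ->
  exists N : int,
    forall t : algC, k t ->
      (t = tp \/ exists m : int, ord_is k P (t - tp) m /\ N <= m) ->
      bX.[t] != 0 -> dY.[t] != 0 ->
      forall y : algC, y ^+ 2 = f.[t] -> y != cY.[t] / dY.[t] ->
      forall Q : algC -> Prop,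
        prime_of (adjoin k y) Q ->
        (forall x, ringOI k x -> (Q x <-> P x)) ->
        exists m : int, ord_is (adjoin k y) Q (y - cY.[t] / dY.[t]) m /\ (3 %| m)%Z.
Proof.
move=> nfk kf _ kaX kbX kcY kdY _ _ _ _ curve prP nP2 ktp _ [m3 [ord_ftp /dvdzP[m Dm]]].
rewrite Dm mulrC in ord_ftp.
have [c [pi [Kc cP Ppi nPcpi]]] := inverse_uniformizer nfk prP.
have sk := proj1 nfk.
have [B hB] := poly_ord_continuous nfk prP Kc cP Ppi nPcpi kf ktp.
(* The bound 0 is what [hB] requires of t - tp; the bound 3m + 1 - B gives f(t) - f(tp) order at
   least 3m + 1, above that of f(tp). *)
exists (Num.max 0 (3 * m + 1 - B)) => t kt near bt dt y y2 yY Q prQ QP.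
have near_t : ord_ge k P c (t - tp) (Num.max 0 (3 * m + 1 - B)).
  case: near => [-> | [n [ord_n le_n]]]; first by rewrite subrr; apply: ord_ge0.
  apply: (ord_ge_le nfk prP cP Ppi nPcpi le_n).
  exact: (ord_is_ge nfk prP Kc cP Ppi nPcpi ord_n).
have ge_max_le n : n <= Num.max 0 (3 * m + 1 - B) -> ord_ge k P c (t - tp) n.
  by move=> le_n; apply: (ord_ge_le nfk prP cP Ppi nPcpi le_n near_t).
have ord_ft : ord_is k P f.[t] (3 * m).
  rewrite -(subrK f.[tp] f.[t]) addrC.
  have [|h -> gh] := hB t; first by apply: ge_max_le; rewrite le_max lexx.
  apply: (ord_isD nfk prP Kc cP Ppi nPcpi ord_ftp).
  rewrite -(subrK B (3 * m + 1)); apply: (ord_geM nfk prP nPcpi) => //.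
  by apply: ge_max_le; rewrite le_max lexx orbT.
have kval (p : {poly algC}) : poly_over k p -> k p.[t].
  by move=> kp; apply: poly_over_horner.
have kdiv u v : k u -> k v -> k (u / v).
  by case: sk => _ [_ [_ [_ [kM kV]]]] ku kv; apply: kM => //; apply: kV.
have nfL : number_field (adjoin k y).
  by apply: number_field_adjoin_sqrt => //; rewrite y2; apply: kval.
have [n ord_y2] := ord_dvd_above nfk prP nfL prQ (@adjoin_sub k y) QP ord_ft.
apply: (@ord_factor_dvd3 _ _ (aX.[t] / bX.[t]) _ _ n nfL prQ) => //.
- by rewrite QP //; apply: OI_nat.
- by apply: adjoin_sub; apply: kdiv; apply: kval.
- by apply: adjoin_sub; apply: kdiv; apply: kval.
- by apply: contra_eq_neq y2 => ->; rewrite expr0n eq_sym; case: ord_ft.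
(* The curve equation at t, divided by the nonzero denominators, is Y^2 = X^3 + y^2. *)
- have /(congr1 (horner^~ t)) := curve; rewrite /= !(hornerM, hornerD, horner_exp) -y2 => curve_t.
  transitivity (y ^+ 2 - (cY.[t] ^+ 2 * bX.[t] ^+ 3) / (bX.[t] ^+ 3 * dY.[t] ^+ 2)).
    by field; rewrite bt dt.
  by rewrite curve_t; field; rewrite bt dt.
- by rewrite y2.
Qed.
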